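(* Let $n>1$ and $t>2$ be two positive integers. Then $\varphi(K_n\boxdot C_t)$ takes the following values in the following cases (nothing is asserted for other pairs $(n,t)$): \[\varphi(K_n \boxdot C_t)= \begin{cases} n+1, & \text{if either } (n,t)=(2,4) \text{ or } (n\geq 9 \text{ and } t=4),\\ n+2, & \text{if either } (n=2 \text{ and } t\neq 4), \text{ or } n\in\{3,4\}, \text{ or } (n\geq 2t+1 \text{ and } t\neq 4). \end{cases}\]
   Context: All graphs are finite and simple. $C_n$ and $K_n$ denote respectively the cycle and the complete graph with $n$ vertices. The subdivision graph $S(G)$ of a graph $G$ is obtained by inserting one new vertex into every edge of $G$. For graphs $G$ and $H$, with $V(G)=\{u_0,\ldots,u_{m-1}\}$, the subdivision-vertex neighbourhood corona (SVN corona) $G\boxdot H$ is the graph obtained from $S(G)$ by adding $m$ vertex-disjoint copies of $H$ (one for each $u_i$) and joining, for each $i$, every vertex of $N_{S(G)}(u_i)$ (the neighbourhood of $u_i$ in $S(G)$) to every vertex of the copy of $H$ associated with $u_i$. A $b$-chromatic coloring of a graph with $k$ colors is a proper coloring with colors $0,\ldots,k-1$ such that, for each color $i$, there is a vertex (a $b$-vertex) of color $i$ having, for each color $j\neq i$, a neighbour of color $j$. The $b$-chromatic number $\varphi(G)$ is the maximum $k$ for which $G$ has a $b$-chromatic coloring with $k$ colors. *)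

(* Defs.v *)
From mathcomp Require Import all_boot.

Set Implicit Arguments.
Unset Strict Implicit.
Unset Printing Implicit Defensive.

Record sgraph := SGraph {
  vertex :> finType;
  adj : rel vertex;
  adj_sym : symmetric adj;
  adj_irrefl : irreflexive adj
}.

Definition complete_adj (n : nat) : rel 'I_n := fun i j => i != j.
Arguments complete_adj : clear implicits.

Fact complete_adj_sym (n : nat) : symmetric (complete_adj n).
Proof. by move=> i j; rewrite /complete_adj eq_sym. Qed.

Fact complete_adj_irrefl (n : nat) : irreflexive (complete_adj n).
Proof. by move=> i; rewrite /complete_adj eqxx. Qed.

Definition complete_graph (n : nat) : sgraph :=
  SGraph (@complete_adj_sym n) (@complete_adj_irrefl n).

(* [ordS i] is i + 1 modulo t.  This is the t-cycle for t >= 3; the conjunct   *)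
(* [i != j] only matters for t = 1, where it removes the loop.                 *)
Definition cycle_adj (t : nat) : rel 'I_t :=
  fun i j => (i != j) && ((j == ordS i) || (i == ordS j)).
Arguments cycle_adj : clear implicits.

Fact cycle_adj_sym (t : nat) : symmetric (cycle_adj t).
Proof. by move=> i j; rewrite /cycle_adj eq_sym orbC. Qed.

Fact cycle_adj_irrefl (t : nat) : irreflexive (cycle_adj t).
Proof. by move=> i; rewrite /cycle_adj eqxx. Qed.

Definition cycle_graph (t : nat) : sgraph :=
  SGraph (@cycle_adj_sym t) (@cycle_adj_irrefl t).

Definition is_edge (G : sgraph) (e : {set G}) : bool :=
  [exists x : G, exists y : G, adj x y && (e == [set x; y])].

Definition edge (G : sgraph) : finType := {e : {set G} | is_edge e}.

(* The vertex inserted into the edge e is [inr e].                             *)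
Definition subdivision_adj (G : sgraph) : rel (G + edge G)%type :=
  fun a b => match a, b with
             | inl u, inr e | inr e, inl u => u \in val e
             | _, _ => false
             end.
Arguments subdivision_adj : clear implicits.

Fact subdivision_adj_sym (G : sgraph) : symmetric (subdivision_adj G).
Proof. by move=> [u|e] [v|f]. Qed.

Fact subdivision_adj_irrefl (G : sgraph) : irreflexive (subdivision_adj G).
Proof. by move=> [u|e]. Qed.

Definition subdivision (G : sgraph) : sgraph :=
  SGraph (@subdivision_adj_sym G) (@subdivision_adj_irrefl G).

(* The vertex h of the copy of H associated with u is [inr (u, h)].            *)
Definition svn_adj (G H : sgraph) : rel (subdivision G + G * H)%type :=
  fun a b => match a, b with
             | inl x, inl y => adj x y
             | inr (u, h), inr (v, k) => (u == v) && adj h k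
             | inl x, inr (u, _) | inr (u, _), inl x =>
                 adj (inl u : subdivision G) x
             end.
Arguments svn_adj : clear implicits.

Fact svn_adj_sym (G H : sgraph) : symmetric (svn_adj G H).
Proof.
move=> [x|[u h]] [y|[v k]] //=; first exact: subdivision_adj_sym.
by rewrite eq_sym adj_sym.
Qed.

Fact svn_adj_irrefl (G H : sgraph) : irreflexive (svn_adj G H).
Proof. move=> [x|[u h]] /=; first exact: subdivision_adj_irrefl.
by rewrite adj_irrefl andbF. Qed.

Definition svn_corona (G H : sgraph) : sgraph :=
  SGraph (@svn_adj_sym G H) (@svn_adj_irrefl G H).

Definition proper_coloring (G : sgraph) (k : nat) (c : {ffun G -> 'I_k}) : bool :=
  [forall x : G, forall y : G, adj x y ==> (c x != c y)].

Definition b_vertex (G : sgraph) (k : nat) (c : {ffun G -> 'I_k}) (v : G) : bool :=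
  [forall j : 'I_k, (j != c v) ==> [exists w : G, adj v w && (c w == j)]].

Definition b_coloring (G : sgraph) (k : nat) (c : {ffun G -> 'I_k}) : bool :=
  proper_coloring c
  && [forall i : 'I_k, exists v : G, (c v == i) && b_vertex c v].

Definition b_colorable (G : sgraph) (k : nat) : bool :=
  [exists c : {ffun G -> 'I_k}, b_coloring c].

(* The bound k <= #|G| loses nothing, by [b_colorable_leq] below.              *)
Definition b_chromatic_number (G : sgraph) : nat :=
  \max_(k < #|G|.+1 | b_colorable G k) k.

Lemma b_colorable_leq (G : sgraph) (k : nat) : b_colorable G k -> k <= #|G|.
Proof.
case/existsP=> c /andP[_ /forallP cP].
rewrite -[k in k <= _]card_ord.
apply: leq_trans (leq_image_card c predT).
apply/subset_leq_card/subsetP=> i _.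
by have /existsP[v /andP[/eqP <- _]] := cP i; exact: image_f.
Qed.

Lemma b_chromatic_number_max (G : sgraph) (k : nat) :
  b_colorable G k -> k <= b_chromatic_number G.
Proof.
move=> Gk; have ltk : k < #|G|.+1 by rewrite ltnS b_colorable_leq.
exact: (@leq_bigmax_cond _ (fun i : 'I_#|G|.+1 => b_colorable G i)
          (@nat_of_ord _) (Ordinal ltk)).
Qed.

(* Main.v *)
Require Import Defs.
From mathcomp Require Import all_boot.
From mathcomp Require Import all_order all_algebra zify.

Set Implicit Arguments.
Unset Strict Implicit.
Unset Printing Implicit Defensive.
Import GRing.Theory.

(* Copy vertices have degree n + 1, edge vertices 2t + 2 and original vertices *)
(* n - 1.  So with n + 3 or more colors only the edge vertices can be          *)
(* b-vertices; they have too small a degree if n > 2t, and are too few if      *)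
(* n <= 4.                                                                     *)
(* Let t = 4 and suppose there are n + 2 colors.  The antipode in its 4-cycle  *)
(* of a copy b-vertex h has the same neighbours as h, hence the same color,    *)
(* and so all the b-vertices of one copy have the same color.  If the edge     *)
(* vertex ij of color x is a b-vertex and n >= 9, then its neighbours have     *)
(* distinct colors, so the copies i and j contain no b-vertex and, writing r_i *)
(* for the indicator vector of the colors of u_i and of its copy,              *)
(* 1_x = 1 - r_i - r_j.  Letting r_i = 1_x instead when the copy i has a       *)
(* b-vertex of color x, the n + 1 vectors 1, r_0, ..., r_(n-1) would span the  *)
(* space of dimension n + 2, which is absurd.  For n = 2 the vector 1 is       *)
(* replaced by the indicator of the color of the only edge.                    *)
(* For the colorings, color K_n with n + 1 colors so that all the colors but   *)
(* two, a_i and b_i, appear around most vertices i, and color copy i with      *)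
(* a_i, b_i alternately if t = 4, or with a_i, b_i and a new color otherwise.  *)

(** The upper bound n + 2 is [b_colorable_complete_cycle_leq], a count of degrees and edges. For
    C_4, [not_b_colorable_complete_C4] rules out n + 2 itself, through [color_delta_edge] and the
    dimension count [leq_of_span]. All colorings come from [complete_corona_b_colorable]: it is fed
    by [palette_exists] in general, and by explicit tables for C_4 with n = 3 and n = 4, where edge
    vertices are among the b-vertices. *)

Lemma b_colorable_nat (G : sgraph) (k : nat) (col : G -> nat) :
  (forall x, col x < k) ->
  (forall x y, adj x y -> col x <> col y) ->
  (forall c, c < k -> exists v, col v = c /\
     forall c', c' < k -> c' <> c -> exists2 w, adj v w & col w = c') ->
  b_colorable G k.
Proof.
move=> col_lt col_adj col_b; apply/existsP.
exists [ffun x => Ordinal (col_lt x)]; apply/andP; split.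
  apply/forallP=> x; apply/forallP=> y; apply/implyP=> /col_adj xy.
  by rewrite !ffunE -val_eqE; apply/eqP.
apply/forallP=> c; have [v [vc vb]] := col_b c (ltn_ord c).
apply/existsP; exists v; rewrite ffunE -val_eqE /= vc eqxx /=.
apply/forallP=> c'; apply/implyP; rewrite ffunE -val_eqE /= vc => /eqP c'c.
have [w vw wc'] := vb c' (ltn_ord c') c'c.
by apply/existsP; exists w; rewrite vw ffunE -val_eqE /= wc' eqxx.
Qed.

(** The picked orientation of the edge is immaterial for symmetric [f], and the default 0 is never
    reached on an edge. *)
Definition edge_color (n : nat) (f : nat -> nat -> nat)
    (e : {set complete_graph n}) : nat :=
  if [pick p : 'I_n * 'I_n | (p.1 != p.2) && (e == [set p.1; p.2])] is Some p
  then f p.1 p.2 else 0.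

Lemma edge_colorE (n : nat) (f : nat -> nat -> nat) (i j : 'I_n) :
  (forall i j, f i j = f j i) -> i != j ->
  edge_color f ([set i; j] : {set complete_graph n}) = f i j.
Proof.
move=> fC ij; rewrite /edge_color; case: pickP => [[i' j'] /= /andP[ij' /eqP E]|].
  move/setP: E => E; have := E i'; have := E j'; have := E i; have := E j.
  rewrite !inE !eqxx ?orbT /= => H0 H1 H2 H3.
  move: ij'; case/orP: H3 => /eqP->; case/orP: H2 => /eqP->; rewrite ?eqxx //.
by move/(_ (i, j)); rewrite /= ij eqxx.
Qed.

Lemma complete_edgeP (n : nat) (e : edge (complete_graph n)) :
  exists i j : 'I_n, i != j /\ val e = [set i; j].
Proof.
case: e => e /= /existsP[i /existsP[j /andP[ij /eqP ->]]].
by exists i, j.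
Qed.

Lemma is_edge_pair (n : nat) (i j : 'I_n) :
  i != j -> is_edge ([set i; j] : {set complete_graph n}).
Proof.
by move=> ij; apply/existsP; exists i; apply/existsP; exists j; rewrite eqxx andbT.
Qed.

(** The edge vertices around u_i are exactly those joined to copy i, so u_i may borrow the color of
    any vertex [h0] of its copy. Each color needs a b-vertex in a copy (first alternative) or on an
    edge (second one). *)
Lemma complete_corona_b_colorable (n : nat) (H : sgraph) (h0 : H) (k : nat)
    (f : nat -> nat -> nat) (q : nat -> H -> nat) :
  (forall i j, f i j = f j i) ->
  (forall i j, i < n -> j < n -> i <> j -> f i j < k) ->
  (forall i h, i < n -> q i h < k) ->
  (forall i j h, i < n -> j < n -> i <> j -> f i j <> q i h) ->
  (forall i h h', i < n -> adj h h' -> q i h <> q i h') ->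
  (forall c, c < k ->
     (exists i h, [/\ i < n, q i h = c & forall c', c' < k -> c' <> c ->
        (exists j, [/\ j < n, i <> j & f i j = c'])
        \/ (exists2 h', adj h h' & q i h' = c')])
     \/ (exists i j, [/\ i < n, j < n, i <> j, f i j = c &
        forall c', c' < k -> c' <> c -> exists h, q i h = c' \/ q j h = c'])) ->
  b_colorable (svn_corona (complete_graph n) H) k.
Proof.
move=> fC fk qk fq qP cP.
pose col (x : svn_corona (complete_graph n) H) : nat :=
  match x with
  | inl (inl u) => q (nat_of_ord u) h0
  | inl (inr e) => edge_color f (val e)
  | inr (u, h) => q (nat_of_ord u) h
  end.
have colE (e : edge (complete_graph n)) (u : 'I_n) : u \in val e ->
    exists v : 'I_n, u != v /\ edge_color f (val e) = f u v.
  have [i [j [ij ->]]] := complete_edgeP e.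
  rewrite !inE edge_colorE // => /orP[] /eqP->; first by exists j.
  by exists i; rewrite eq_sym fC.
have neq (i j : 'I_n) : i != j -> i <> j :> nat by move=> /eqP H1 /val_inj.
apply: (@b_colorable_nat _ _ col).
- move=> [[u|e]|[u h]] /=; [exact: qk|  |exact: qk].
  have [i [j [ij ->]]] := complete_edgeP e.
  by rewrite edge_colorE //; apply: fk => //; exact: neq.
- have E (e : edge (complete_graph n)) (u : 'I_n) h :
      u \in val e -> edge_color f (val e) <> q (nat_of_ord u) h.
    by move=> /colE[v [uv ->]]; apply: fq => //; exact: neq.
  move=> [[u|e]|[u h]] [[v|e']|[v h']] //=; try by move/E.
  + by move/(E e' u h0)/nesym.
  + by move/(E e' u h)/nesym.
  + by case/andP=> /eqP-> hh'; exact: qP.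
- move=> c ck; case: (cP c ck) => [[i [h [lin qc Hc]]]|[i [j [lin ljn ij fc Hc]]]].
    exists (inr (Ordinal lin, h)); split=> // c' c'k c'c.
    case: (Hc c' c'k c'c) => [[j [ljn ij fc']]|[h' hh' qc']].
      have ij' : Ordinal lin != Ordinal ljn by rewrite -val_eqE; apply/eqP.
      exists (inl (inr (Sub _ (is_edge_pair ij')))); rewrite /= ?SubK ?inE ?eqxx //.
      by rewrite edge_colorE.
    by exists (inr (Ordinal lin, h')); rewrite //= eqxx.
  have ij' : Ordinal lin != Ordinal ljn by rewrite -val_eqE; apply/eqP.
  exists (inl (inr (Sub _ (is_edge_pair ij')))); rewrite /= ?SubK edge_colorE //.
  split=> // c' c'k c'c; have [h [] qc'] := Hc c' c'k c'c.
    by exists (inr (Ordinal lin, h)); rewrite //= ?SubK !inE eqxx.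
  by exists (inr (Ordinal ljn, h)); rewrite //= ?SubK !inE eqxx orbT.
Qed.

(** * Edge colorings of K_n with two free colors at each vertex *)

(* [f] colors the edges of K_n with the colors 0, ..., n, and [a i] and [b i]  *)
(* are two colors free at the vertex i.  In the last clause, either every      *)
(* other color appears around i, or (only for n = 2) the edge ij will itself   *)
(* be a b-vertex.                                                              *)
Definition palette (n : nat) (f : nat -> nat -> nat) (a b : nat -> nat) : Prop :=
  [/\ forall i j, f i j = f j i,
      forall i, i < n -> [/\ a i <= n, b i <= n & a i <> b i],
      forall i j, i < n -> j < n -> i <> j ->
        [/\ f i j <= n, f i j <> a i & f i j <> b i] &
      forall c, c <= n ->
        (exists i, [/\ i < n, a i = c \/ b i = c & forall c', c' <= n ->
           [\/ c' = a i, c' = b i | exists j, [/\ j < n, i <> j & f i j = c']]])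
        \/ (exists i j, [/\ i < n, j < n, i <> j, f i j = c &
           forall c', c' <= n -> c' <> c -> c' = a i \/ c' = b i])].

Lemma modn_add_inj (m i j l : nat) :
  j < m -> l < m -> (i + j) %% m = (i + l) %% m -> j = l.
Proof.
by move=> jm lm /eqP; rewrite eqn_modDl !modn_small // => /eqP.
Qed.

Lemma modn_add_onto (m i c : nat) :
  i < m -> c < m -> exists2 j, j < m & (i + j) %% m = c.
Proof.
move=> im cm; have m0 : 0 < m by lia.
exists ((c + (m - i)) %% m); first by rewrite ltn_mod.
rewrite modnDmr.
have -> : i + (c + (m - i)) = c + m by lia.
by rewrite modnDr modn_small.
Qed.

(** One of [c] and [c + m] is even, and its half is below [m]. *)
Lemma modn_double_onto (m c : nat) :
  odd m -> c < m -> exists2 i, i < m & (i + i) %% m = c.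
Proof.
move=> om cm; case oc: (odd c).
  exists ((c + m)./2); first by lia.
  have -> : (c + m)./2 + (c + m)./2 = c + m by lia.
  by rewrite modnDr modn_small.
exists (c./2); first by lia.
have -> : c./2 + c./2 = c by lia.
by rewrite modn_small.
Qed.

Lemma palette_exists (n : nat) : 1 < n -> exists f a b, palette n f a b.
Proof.
move=> n1; have [n2|n2] := eqVneq n 2.
  exists (fun _ _ => 2), (fun _ => 0), (fun _ => 1); subst n; split=> //.
  move=> c c2; have [->|c2'] := eqVneq c 2.
    by right; exists 0, 1; split=> // c'; lia.
  left; exists 0; split=> //; first by lia.
  move=> c' c'2; have [->|c'2'] := eqVneq c' 2; first by apply: Or33; exists 1.
  have [->|->] : c' = 0 \/ c' = 1 by lia.
    by apply: Or31.
  by apply: Or32.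
(* Color ij with i + j modulo the odd number m.  If m = n - 1, the edges at the
   remaining vertex m get the color m, except for the edge 0m, so that the color
   m is free at 0. *)
pose m := n - ~~ odd n.
have om : odd m by rewrite /m; lia.
have m3 : 2 < m by move: om; rewrite /m; lia.
have mn : m = n \/ m.+1 = n by rewrite /m; lia.
have m0 : 0 < m by lia.
pose f i j := if (i < m) && (j < m) then (i + j) %% m
              else if (i == 0) || (j == 0) then n else m.
(* The residue 2i is the only one missing around i < m, as it would need j = i. If m = n - 1, [b i]
   is whichever of m and n the edge im does not use. Around the vertex m only m and n occur, so 0
   and 1 are free there. *)
pose a i := if i < m then (i + i) %% m else 0.
pose b i := if i < m then (if (m < n) && (i == 0) then m else n) else 1.
have modm x : x %% m < m by rewrite ltn_mod.
have cover i : i < m -> forall c', c' <= n ->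
   [\/ c' = a i, c' = b i | exists j, [/\ j < n, i <> j & f i j = c']].
  move=> im c' c'n; rewrite /a /b im.
  case: (ltnP c' m) => c'm.
    have [j jm jc] := modn_add_onto im c'm.
    have [ij|ij] := eqVneq i j; first by apply: Or31; rewrite {2}ij.
    apply: Or33; exists j; rewrite /f im jm jc; split=> //; [lia|exact/eqP].
  have [E|E] := eqVneq c' (if (m < n) && (i == 0) then m else n); first by apply: Or32.
  move: E; have [m_n|m_n] := ltnP m n => /= E; last by lia.
  apply: Or33; exists m; split=> //; first by lia.
  by rewrite /f ltnn andbF (gtn_eqF m0) orbF; move: E; case: ifP; lia.
exists f, a, b; split.
- by move=> i j; rewrite /f addnC andbC orbC.
- move=> i lin; rewrite /a /b; case: ifP => im; last by split; lia.
  have := modm (i + i); case: ifP => _; split; lia.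
- move=> i j lin ljn ij; rewrite /f /a /b.
  case: (ltnP i m) => im /=; last by case: ifP; split; lia.
  case: (ltnP j m) => jm.
    have := modm (i + j); split; [lia| |by case: ifP; lia].
    by move=> /(modn_add_inj jm im) /esym.
  have := modm (i + i); case: ifP; case: ifP; split; lia.
(* Residues are of the form 2i because m is odd; the color n is free at 1, and m, when it differs
   from n, is free at 0. *)
- move=> c cn; left; have [cm|cm] := ltnP c m.
    have [i im ic] := modn_double_onto om cm.
    exists i; split; [lia| |exact: cover].
    by left; rewrite /a im.
  have [->|c_n] := eqVneq c n.
    exists 1; split; [lia| |by apply: cover; lia].
    by right; rewrite /b andbF (ltn_trans _ m3).
  exists 0; split; [lia| |exact: cover].
  right; rewrite /b m0 eqxx andbT; case: ltnP; lia.
Qed.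

(** * Three-colorings of the cycle *)

Lemma cycle_adjE (t : nat) (h k : cycle_graph t) : 2 < t ->
  adj h k = [|| k == h.+1 :> nat, h == k.+1 :> nat,
                (h == 0 :> nat) && (k.+1 == t) | (k == 0 :> nat) && (h.+1 == t)].
Proof.
move=> t2; have SE (x : 'I_t) : ordS x = (if x.+1 == t then 0 else x.+1) :> nat.
  rewrite /=; have [->|xt] := eqVneq x.+1 t; first by rewrite modnn.
  by rewrite modn_small //; have := ltn_ord x; lia.
rewrite /= /cycle_adj -!(inj_eq val_inj) /= -/(nat_of_ord (ordS h)).
have := SE h; have := SE k; have := ltn_ord h; have := ltn_ord k.
by rewrite /= => h1 h2 -> ->; case: ifP; case: ifP; lia.
Qed.

(* The coloring 0 1 2 0 1 2 1 2 1 2 ... of the cycle. *)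
Definition cycle3_color (p : nat) : nat :=
  if (p == 0) || (p == 3) then 0 else
  if (p == 2) || odd p && (p != 1) then 2 else 1.

(** The closing edge is the only danger: it joins two vertices of color 0 exactly when its last
    vertex is 3, that is, for t = 4. *)
Lemma cycle3_color_proper (t : nat) (h k : cycle_graph t) :
  2 < t -> t <> 4 -> adj h k -> cycle3_color h <> cycle3_color k.
Proof.
move=> t2 t4; rewrite cycle_adjE // /cycle3_color.
have := ltn_ord h; have := ltn_ord k.
by do ?case: ifP; lia.
Qed.

Lemma cycle3_color_b (t r : nat) : 2 < t -> t <> 4 -> r < 3 ->
  exists2 h : cycle_graph t, cycle3_color h = r &
    forall r', r' < 3 -> r' <> r ->
      exists2 k : cycle_graph t, adj h k & cycle3_color k = r'.
Proof.
move=> t2 t4 r3.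
have [t3|t3] := eqVneq t 3.
  subst t; exists (Ordinal r3); first by case: r r3 => [|[|[|]]].
  move=> r' r'3 r'r; exists (Ordinal r'3); last by case: r' r'3 r'r => [|[|[|]]].
  by rewrite cycle_adjE //=; lia.
have t4' : 4 < t by lia.
(* The vertices 3, 1, 2 serve for the colors 0, 1, 2. Vertex 3 is preferred to vertex 0 because its
   neighbours 2 and 4 have colors independent of t. *)
pose w := if r == 0 then 3 else r.
have wt : w < t by rewrite /w; case: ifP; lia.
exists (Ordinal wt); first by case: r r3 @w wt => [|[|[|]]].
move=> r' r'3 r'r.
pose s := if r == 0 then (if r' == 2 then 2 else 4) else
  if r == 1 then r' else if r' == 1 then 1 else 3.
have st : s < t by rewrite /s; do ?case: ifP; lia.
exists (Ordinal st).
  by rewrite cycle_adjE //= /s /w; do ?case: ifP; lia.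
by move: r' r'3 r'r @s st; case: r r3 @w wt => [|[|[|]]] // _ w wt [|[|[|]]].
Qed.

(** * Lower bounds *)

Lemma b_colorable_complete_C4 (n : nat) :
  1 < n -> b_colorable (svn_corona (complete_graph n) (cycle_graph 4)) n.+1.
Proof.
move=> n1; have [f [a [b [fC ab fab cov]]]] := palette_exists n1.
pose q i (h : cycle_graph 4) := if odd h then b i else a i.
have qab i c (h : cycle_graph 4) : c = a i \/ c = b i ->
    q i h = c \/ exists2 k : cycle_graph 4, adj h k & q i k = c.
  have [k hk] : exists k : cycle_graph 4, adj h k.
    by exists (ordS h); case: h => [[|[|[|[|]]]]].
  have ok : odd k = ~~ odd h.
    by move: hk; rewrite cycle_adjE //; have := ltn_ord h; have := ltn_ord k; lia.
  rewrite /q => -[] ->; case oh: (odd h); [right|left|left|right] => //;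
  by exists k => //; rewrite ok oh.
apply: (@complete_corona_b_colorable n (cycle_graph 4) ord0 n.+1 f q) => //.
- by move=> i j il jl ij; case: (fab i j).
- by move=> i h il; rewrite /q; case: (ab i il) => ? ? _; case: ifP.
- by move=> i j h il jl ij; case: (fab i j) => //; rewrite /q; case: ifP.
- move=> i h k il; rewrite cycle_adjE // /q; case: (ab i il) => _ _ H.
  by have := ltn_ord h; have := ltn_ord k; do ?case: ifP; lia.
- move=> c cn; case: (cov c cn) => [[i [il ci H]]|[i [j [il jl ij fc H]]]]; [left|right].
  + have [h qh] : exists h, q i h = c.
      by case: ci => <-; [exists ord0|exists (Ordinal (isT : 1 < 4))].
    exists i, h; split=> // c' c'n c'c.
    have H' : c' = a i \/ c' = b i -> exists2 k : cycle_graph 4, adj h k & q i k = c'.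
      by case/(qab _ _ h) => // E; case: c'c; rewrite -E.
    by case: (H c' c'n) => E; [right; apply: H'; left|right; apply: H'; right|left].
  + exists i, j; split=> // c' c'n c'c.
    have [E|[k _ E]] := qab i c' ord0 (H c' c'n c'c); [exists ord0|exists k]; by left.
Qed.

Lemma b_colorable_complete_cycle (n t : nat) : 1 < n -> 2 < t -> t <> 4 ->
  b_colorable (svn_corona (complete_graph n) (cycle_graph t)) n.+2.
Proof.
move=> n1 t2 t4; have [f [a [b [fC ab fab cov]]]] := palette_exists n1.
pose g i r := if r == 0 then a i else if r == 1 then b i else n.+1.
pose q i (h : cycle_graph t) := g i (cycle3_color h).
have c3 h : cycle3_color h < 3 by rewrite /cycle3_color; do ?case: ifP.
have g_inj i r r' : i < n -> r < 3 -> r' < 3 -> g i r = g i r' -> r = r'.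
  move=> il; have [] := ab i il; rewrite /g => ? ? ? r3 r'3.
  by do ?case: ifP; lia.
have gE i c : c = a i \/ c = b i \/ c = n.+1 -> exists2 r, r < 3 & g i r = c.
  by case=> [|[]] ->; [exists 0|exists 1|exists 2].
have t0 : 0 < t by lia.
have copy_b i c : i < n -> (c = a i \/ c = b i \/ c = n.+1) ->
    (forall c', c' <= n ->
       [\/ c' = a i, c' = b i | exists j, [/\ j < n, i <> j & f i j = c']]) ->
    exists i h, [/\ i < n, q i h = c & forall c', c' < n.+2 -> c' <> c ->
      (exists j, [/\ j < n, i <> j & f i j = c'])
      \/ (exists2 h', adj h h' & q i h' = c')].
  move=> il /gE[r r3 <-] H; have [h hr Hh] := cycle3_color_b t2 t4 r3.
  exists i, h; split=> //; first by rewrite /q hr.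
  move=> c' c'n c'c.
  have H' : c' = a i \/ c' = b i \/ c' = n.+1 -> exists2 k, adj h k & q i k = c'.
    move=> /gE[r' r'3 E]; have [|k hk kr'] := Hh r' r'3.
      by move=> rr; case: c'c; rewrite -E rr.
    by exists k => //; rewrite /q kr'.
  have [E|c'n1] := eqVneq c' n.+1; first by right; apply: H'; right; right.
  have [|E|E|] := H c'; [lia|right..|left] => //; apply: H'; [by left|by right; left].
have onto i c : c = a i \/ c = b i \/ c = n.+1 -> exists h, q i h = c.
  move=> /gE[r r3 <-]; have [h hr _] := cycle3_color_b t2 t4 r3.
  by exists h; rewrite /q hr.
apply: (@complete_corona_b_colorable n (cycle_graph t) (Ordinal t0) n.+2 f q) => //.
- by move=> i j il jl ij; case: (fab i j) => // ? _ _; lia.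
- by move=> i h il; rewrite /q /g; case: (ab i il) => ? ? _; do ?case: ifP; lia.
- move=> i j h il jl ij; case: (fab i j) => // ? ? ?; rewrite /q /g.
  by do ?case: ifP; lia.
- by move=> i h k il hk /g_inj E; apply: cycle3_color_proper hk _ => //; apply: E.
- move=> c; rewrite ltnS leq_eqVlt => /orP[/eqP ->|cn].
    (* The new color n + 1 lies in every copy, so any vertex i around which the old colors appear
       will do. If the palette yields an edge ij of color n, this edge supplies n at i, and [a i],
       [b i] supply the rest. *)
    left; have [[i [il _ H]]|[i [j [il jl ij fc H]]]] := cov n (leqnn n).
      by apply: (copy_b i) H => //; right; right.
    apply: (copy_b i) => // [|c' c'n]; first by right; right.
    have [->|/eqP c'n'] := eqVneq c' n; first by apply: Or33; exists j.
    by case: (H c' c'n c'n'); [constructor 1|constructor 2].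
  have [[i [il ci H]]|[i [j [il jl ij fc H]]]] := cov c cn; [left|right].
    by apply: (copy_b i) H => //; case: ci; [left|right; left].
  exists i, j; split=> // c' c'n c'c.
  have [h E] : exists h, q i h = c'.
    apply: onto; have [->|c'n1] := eqVneq c' n.+1; first by right; right.
    have c'n2 : c' <= n by lia.
    by case: (H c' c'n2 c'c); [left|right; left].
  by exists h; left.
Qed.

(** The b-vertices are the edges 01 and 02 for the colors 0 and 1, and the vertex 1 of copy i for
    the color i + 2. *)
Lemma b_colorable_K3_C4 :
  b_colorable (svn_corona (complete_graph 3) (cycle_graph 4)) 5.
Proof.
pose f i j := (i + j).-1.
pose q i (h : cycle_graph 4) :=
  nth 0 (nth [::] [:: [:: 3; 2; 4; 2]; [:: 1; 3; 4; 3]; [:: 0; 4; 3; 4]] i) h.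
apply: (@complete_corona_b_colorable 3 (cycle_graph 4) ord0 5 f q).
- by move=> i j; rewrite /f addnC.
- by case=> [|[|[|]]] //; case=> [|[|[|]]].
- by case=> [|[|[|]]] //; case=> [[|[|[|[|]]]]].
- by case=> [|[|[|]]] //; case=> [|[|[|]]] // [[|[|[|[|]]]]].
- move=> i h k i3; rewrite cycle_adjE //.
  by case: i i3 => [|[|[|]]] // _;
    case: h => [[|[|[|[|]]]] ?] //; case: k => [[|[|[|[|]]]] ?].
have edge_b i j : i < 3 -> j < 3 -> i <> j ->
  (forall c', c' < 5 -> c' <> f i j -> exists h, q i h = c' \/ q j h = c') ->
  exists i' j', [/\ i' < 3, j' < 3, i' <> j', f i' j' = f i j & forall c', c' < 5 ->
      c' <> f i j -> exists h, q i' h = c' \/ q j' h = c'] by exists i, j.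
pose o p (p4 : p < 4) : cycle_graph 4 := Ordinal p4.
have copy_b i : i < 3 ->
  (forall c', c' < 5 -> c' <> i.+2 -> (exists j, [/\ j < 3, i <> j & f i j = c']) \/
    (exists2 h, adj (o 1 isT) h & q i h = c')) ->
  exists i' h, [/\ i' < 3, q i' h = i.+2 & forall c', c' < 5 -> c' <> i.+2 ->
    (exists j, [/\ j < 3, i' <> j & f i' j = c']) \/
    (exists2 h', adj h h' & q i' h' = c')].
  move=> i3 H; exists i, (o 1 isT); split=> //.
  by case: i i3 {H} => [|[|[|]]].
have adj0 : adj (o 1 isT) (o 0 isT) by rewrite cycle_adjE.
have adj2 : adj (o 1 isT) (o 2 isT) by rewrite cycle_adjE.
case=> [|[|[|[|[|]]]]] // _; [right|right|left|left|left].
- apply: (edge_b 0 1) => //; case=> [|[|[|[|[|]]]]] // _ _.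
  + by exists (o 0 isT); right.
  + by exists (o 1 isT); left.
  + by exists (o 0 isT); left.
  + by exists (o 2 isT); left.
- apply: (edge_b 0 2) => //; case=> [|[|[|[|[|]]]]] // _ _.
  + by exists (o 0 isT); right.
  + by exists (o 1 isT); left.
  + by exists (o 0 isT); left.
  + by exists (o 2 isT); left.
- apply: (copy_b 0) => //; case=> [|[|[|[|[|]]]]] // _ _.
  + by left; exists 1.
  + by left; exists 2.
  + by right; exists (o 0 isT).
  + by right; exists (o 2 isT).
- apply: (copy_b 1) => //; case=> [|[|[|[|[|]]]]] // _ _.
  + by left; exists 0.
  + by right; exists (o 0 isT).
  + by left; exists 2.
  + by right; exists (o 2 isT).
- apply: (copy_b 2) => //; case=> [|[|[|[|[|]]]]] // _ _.
  + by right; exists (o 0 isT).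
  + by left; exists 0.
  + by left; exists 1.
  + by right; exists (o 2 isT).
Qed.

Lemma b_colorable_K4_C4 :
  b_colorable (svn_corona (complete_graph 4) (cycle_graph 4)) 6.
Proof.
pose f i j := if (i == 0) || (j == 0) then (i + j).-1 else i + j.
(* The edges get distinct colors, and copy i those of the triangle opposite to
   i: then the two copies at an edge have all the colors but the edge's own. *)
pose s i := nth [::] [:: [:: 3; 4; 5]; [:: 1; 2; 5]; [:: 0; 2; 4]; [:: 0; 1; 3]] i.
pose q i (h : cycle_graph 4) := nth 0 (s i) (if odd h then h.-1./2.+1 else 0).
have fC i j : f i j = f j i by rewrite /f orbC addnC.
apply: (@complete_corona_b_colorable 4 (cycle_graph 4) ord0 6 f q) => //.
- by case=> [|[|[|[|]]]] //; case=> [|[|[|[|]]]].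
- by case=> [|[|[|[|]]]] //; case=> [[|[|[|[|]]]]].
- by case=> [|[|[|[|]]]] //; case=> [|[|[|[|]]]] // [[|[|[|[|]]]]].
- move=> i h k i3; rewrite cycle_adjE //.
  by case: i i3 => [|[|[|[|]]]] // _;
    case: h => [[|[|[|[|]]]] ?] //; case: k => [[|[|[|[|]]]] ?].
have q_onto i c : i < 4 -> c \in s i -> exists h, q i h = c.
  move=> i4; have : size (s i) = 3 by case: i i4 => [|[|[|[|]]]].
  rewrite /q; case: (s i) => [|x [|y [|z []]]] //= _; rewrite !inE.
  by case/or3P=> /eqP->;
    [exists ord0|exists (Ordinal (isT : 1 < 4))|exists (Ordinal (isT : 3 < 4))].
have edge_b i j : i < 4 -> j < 4 -> i <> j ->
  (forall c', c' < 6 -> c' <> f i j -> (c' \in s i) || (c' \in s j)) ->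
  exists i' j', [/\ i' < 4, j' < 4, i' <> j', f i' j' = f i j & forall c', c' < 6 ->
      c' <> f i j -> exists h, q i' h = c' \/ q j' h = c'].
  move=> i4 j4 ij H; exists i, j; split=> // c' c'6 c'f.
  by case/orP: (H c' c'6 c'f) => /q_onto[] // h; exists h; [left|right].
case=> [|[|[|[|[|[|]]]]]] // _; right.
- by apply: (edge_b 0 1) => //; case=> [|[|[|[|[|[|]]]]]].
- by apply: (edge_b 0 2) => //; case=> [|[|[|[|[|[|]]]]]].
- by apply: (edge_b 0 3) => //; case=> [|[|[|[|[|[|]]]]]].
- by apply: (edge_b 1 2) => //; case=> [|[|[|[|[|[|]]]]]].
- by apply: (edge_b 1 3) => //; case=> [|[|[|[|[|[|]]]]]].
- by apply: (edge_b 2 3) => //; case=> [|[|[|[|[|[|]]]]]].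
Qed.

(** * Degrees and the upper bound n + 2 *)

Definition neighbours (G : sgraph) (v : G) : {set G} := [set w | adj v w].

Section BVertex.
Variables (G : sgraph) (k : nat) (c : {ffun G -> 'I_k}).

Lemma b_vertex_sub v : b_vertex c v -> [set~ c v] \subset c @: neighbours v.
Proof.
move/forallP=> bv; apply/subsetP=> j; rewrite !inE => jv.
have /existsP[w /andP[vw /eqP <-]] := implyP (bv j) jv.
by apply: imset_f; rewrite inE.
Qed.

Lemma b_vertex_degree v : b_vertex c v -> k.-1 <= #|neighbours v|.
Proof.
move/b_vertex_sub/subset_leq_card; rewrite cardsC1 card_ord => H.
exact: leq_trans H (leq_imset_card _ _).
Qed.

Lemma b_vertex_inj v : b_vertex c v -> #|neighbours v| < k ->
  {in neighbours v &, injective c}.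
Proof.
move/b_vertex_sub/subset_leq_card; rewrite cardsC1 card_ord => H dk.
apply/imset_injP; rewrite eqn_leq leq_imset_card; apply: leq_trans H; lia.
Qed.

Lemma b_vertex_imset v : proper_coloring c -> b_vertex c v ->
  c @: neighbours v = [set~ c v].
Proof.
move=> cP bv; apply/eqP; rewrite eqEsubset b_vertex_sub // andbT.
apply/subsetP=> x /imsetP[w + ->]; rewrite !inE => vw.
by have /forallP/(_ w)/implyP/(_ vw) := forallP cP v; rewrite eq_sym.
Qed.
End BVertex.

Section Degrees.
(** The degrees of the three kinds of vertices of the corona bound the number of colors for which
    each kind can contain b-vertices. *)
Variables (n : nat) (H : sgraph).
Local Notation G := (svn_corona (complete_graph n) H).

Lemma card_sum_set (A B : finType) (P : pred (A + B)) :
  #|[set x | P x]| = #|[set a | P (inl a)]| + #|[set b | P (inr b)]|.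
Proof. by rewrite !cardsE -!sum1_card big_sumType. Qed.

Lemma card_incident (u : complete_graph n) :
  #|[set e : edge (complete_graph n) | u \in val e]| <= n.-1.
Proof.
rewrite -(card_imset _ val_inj).
apply: (@leq_trans #|[set [set u; v] | v in [set~ u]]|); last first.
  by apply: leq_trans (leq_imset_card _ _) _; rewrite cardsC1 card_ord.
apply/subset_leq_card/subsetP=> x /imsetP[e + ->]; rewrite inE => ue.
have [i [j [ij E]]] := complete_edgeP e; move: ue; rewrite E !inE.
case/orP=> /eqP->; first by apply/imsetP; exists j; rewrite // !inE eq_sym.
by apply/imsetP; exists i; rewrite ?inE // setUC.
Qed.

Lemma degree_vertex (u : complete_graph n) :
  #|neighbours (inl (inl u) : G)| <= n.-1.
Proof.
rewrite /neighbours card_sum_set card_sum_set /=.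
rewrite (_ : [set a | _] = set0) ?cards0; last by apply/setP=> v; rewrite !inE.
rewrite (_ : [set b : complete_graph n * H | _] = set0) ?cards0; last first.
  by apply/setP=> -[v h]; rewrite !inE.
by rewrite add0n addn0 card_incident.
Qed.

Lemma degree_copy (u : complete_graph n) (h : H) :
  #|neighbours (inr (u, h) : G)| <= n.-1 + #|neighbours h|.
Proof.
rewrite /neighbours card_sum_set card_sum_set /=.
rewrite (_ : [set _ | false] = set0) ?cards0; last by apply/setP=> v; rewrite !inE.
rewrite add0n; apply: leq_add; first exact: card_incident.
have <- : #|pair u @: neighbours h| = #|neighbours h| by rewrite card_imset // => x y [].
apply/subset_leq_card/subsetP=> -[v k]; rewrite !inE => /andP[/eqP<- hk].
by apply: imset_f; rewrite inE.
Qed.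

(** Stated for any commutative monoid, to serve both for the degree and for sums of color
    vectors. *)
Lemma big_neighbours_edge (R : Type) (idx : R) (op : Monoid.com_law idx)
    (e : edge (complete_graph n)) (F : G -> R) :
  \big[op/idx]_(w in neighbours (inl (inr e) : G)) F w =
  \big[op/idx]_(u in val e) op (F (inl (inl u))) (\big[op/idx]_h F (inr (u, h))).
Proof.
rewrite big_split pair_big big_sumType big_sumType /=.
congr (op _ _); last first.
  by apply: eq_big => [[u h]|[u h] _] //; rewrite inE /= andbT.
rewrite [X in op _ X]big_pred0 => [|f]; last by rewrite inE.
by rewrite Monoid.mulm1; apply: eq_bigl => u; rewrite inE.
Qed.

Lemma degree_edge (e : edge (complete_graph n)) :
  #|neighbours (inl (inr e) : G)| = 2 * #|H|.+1.
Proof.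
rewrite -sum1_card big_neighbours_edge.
have [i [j [ij ->]]] := complete_edgeP e.
by rewrite sum_nat_const cards2 ij sum1_card.
Qed.

Lemma card_complete_edge : #|edge (complete_graph n)| <= 'C(n, 2).
Proof.
rewrite -[n in 'C(n, _)]card_ord -cardsT -(card_imset _ val_inj) -card_draws.
apply/subset_leq_card/subsetP=> _ /imsetP[e _ ->].
by have [i [j [ij ->]]] := complete_edgeP e; rewrite inE cards2 ij.
Qed.
End Degrees.

Lemma degree_cycle (t : nat) (h : cycle_graph t) : #|neighbours h| <= 2.
Proof.
apply: leq_trans (_ : #|[set ordS h; ord_pred h]| <= _); last first.
  by rewrite cards2; case: eqP.
apply/subset_leq_card/subsetP=> k; rewrite !inE /= /cycle_adj.
by case/andP=> _ /orP[->|/eqP->] //; rewrite ordSK eqxx orbT.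
Qed.

Lemma b_vertex_edge (n t k : nat) (c : {ffun svn_corona (complete_graph n)
    (cycle_graph t) -> 'I_k}) v :
  0 < n -> n.+2 < k -> b_vertex c v -> exists e, v = inl (inr e) /\ k <= 2 * t + 3.
Proof.
move=> n0 nk /b_vertex_degree; case: v => [[u|e]|[u h]].
- move=> H; exfalso; have := leq_trans H (degree_vertex _ u); lia.
- by rewrite degree_edge card_ord => kt; exists e; split=> //; lia.
- move=> H; exfalso; have := leq_trans H (degree_copy u h); have := degree_cycle h; lia.
Qed.

(** With k > n + 2, the bound k <= 2t + 3 contradicts n > 2t. Otherwise k colors need k edges, while
    n(n - 1)/2 <= n + 2 for n <= 4, with equality at n = 4. *)
Lemma b_colorable_complete_cycle_leq (n t k : nat) :
  1 < n -> n <= 4 \/ 2 * t < n ->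
  b_colorable (svn_corona (complete_graph n) (cycle_graph t)) k -> k <= n.+2.
Proof.
move=> n1 nt /existsP[c /andP[cP /forallP bP]]; rewrite leqNgt; apply/negP=> nk.
have k0 : 0 < k by lia.
have E (x : 'I_k) : exists e, c (inl (inr e)) = x /\ k <= 2 * t + 3.
  have /existsP[v /andP[/eqP vx /b_vertex_edge]] := bP x.
  by case=> // [|e [ve kt]]; [lia|exists e; rewrite -ve].
have [e [_ kt]] := E (Ordinal k0); case: nt => [n4|]; last by lia.
have kE : k <= #|edge (complete_graph n)|.
  rewrite -[k in k <= _]card_ord.
  apply: leq_trans (leq_image_card (fun e => c (inl (inr e))) predT).
  by apply/subset_leq_card/subsetP=> x _; have [f [<- _]] := E x; exact: image_f.
have := leq_trans kE (card_complete_edge n).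
by case: n n1 n4 nk {c cP bP E e kt kE} => [|[|[|[|[|]]]]] //= _ _;
  case: k k0 => [|[|[|[|[|[|[|]]]]]]].
Qed.

(** * Excluding n + 2 colors for C_4 *)

Lemma leq_of_span (F : fieldType) (n k : nat) (w : 'rV[F]_k) (M : 'M[F]_(n, k)) :
  (forall x, (delta_mx ord0 x : 'rV_k) <= w + M)%MS -> k <= n.+1.
Proof.
move=> H; have /mxrankS : ((1%:M)%R <= w + M)%MS.
  by apply/row_subP=> x; rewrite row1.
rewrite mxrank1 => /leq_trans-> //.
apply: leq_trans (mxrank_adds_leqif _ _) _.
exact: (leq_add (rank_leq_row w) (rank_leq_row M)).
Qed.

(** If [c v'] differed from [c v], it would occur on a neighbour of [v], which is also a neighbour
    of [v']. *)
Lemma b_vertex_twin (G : sgraph) (k : nat) (c : {ffun G -> 'I_k}) (v v' : G) :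
  proper_coloring c -> b_vertex c v -> (forall w, adj v w -> adj v' w) ->
  c v' = c v.
Proof.
move=> cP bv vv'; apply/eqP/negPn/negP=> cvv'.
have : c v' \in [set~ c v] by rewrite !inE.
rewrite -b_vertex_imset // => /imsetP[w]; rewrite inE => /vv' v'w cw.
by have /forallP/(_ w)/implyP/(_ v'w)/eqP := forallP cP v'.
Qed.

Definition antipode (h : cycle_graph 4) : cycle_graph 4 := ordS (ordS h).

Lemma antipode_neq h : antipode h != h.
Proof. by case: h => [[|[|[|[|]]]]]. Qed.

Lemma adj_antipode h k : adj (antipode h) k = adj h k.
Proof.
by rewrite !cycle_adjE //;
    case: h => [[|[|[|[|]]]] ?] //; case: k => [[|[|[|[|]]]] ?].
Qed.

Lemma C4_cases (h k : cycle_graph 4) : [\/ k = h, k = antipode h | adj h k].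
Proof.
have [E|kh] := eqVneq k h; first by apply: Or31.
have [E|ka] := eqVneq k (antipode h); first by apply: Or32.
apply: Or33; rewrite cycle_adjE //; move: kh ka.
by case: h => [[|[|[|[|]]]] ?] //; case: k => [[|[|[|[|]]]] ?].
Qed.

Section C4.
Variables (n k : nat).
Local Notation G := (svn_corona (complete_graph n) (cycle_graph 4)).
Variable c : {ffun G -> 'I_k}.
Hypothesis cP : proper_coloring c.

Lemma color_antipode (u : complete_graph n) (h : cycle_graph 4) :
  b_vertex c (inr (u, h)) -> c (inr (u, antipode h)) = c (inr (u, h)).
Proof.
by move=> bv; apply: b_vertex_twin => // -[x|[v l]] //; have /= -> := adj_antipode h l.
Qed.

(** If [h] and [h'] were adjacent, [h'] would have the equally colored neighbours [h] and its
    antipode; but its degree is at most n + 1 < k, so all its neighbours have distinct colors. *)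
Lemma b_vertex_copy_color (u : complete_graph n) (h h' : cycle_graph 4) :
  0 < n -> n.+1 < k -> b_vertex c (inr (u, h)) -> b_vertex c (inr (u, h')) ->
  c (inr (u, h')) = c (inr (u, h)).
Proof.
move=> n0 nk bh bh'; have [->|->|hh'] := C4_cases h h'; [by []|exact: color_antipode|].
have dk : #|neighbours (inr (u, h') : G)| < k.
  apply: leq_ltn_trans (degree_copy u h') _.
  by have := degree_cycle h'; lia.
have Nh' l : adj h' l -> inr (u, l) \in neighbours (inr (u, h') : G).
  by move=> hl; rewrite inE /= eqxx.
have ah : inr (u, antipode h) \in neighbours (inr (u, h') : G).
  by apply: Nh'; rewrite adj_sym adj_antipode.
have h'h : inr (u, h) \in neighbours (inr (u, h') : G) by apply: Nh'; rewrite adj_sym.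
have [/eqP] := b_vertex_inj bh' dk ah h'h (color_antipode bh).
by rewrite (negPf (antipode_neq h)).
Qed.

Lemma b_vertex_edge_copy (e : edge (complete_graph n)) (u : complete_graph n)
    (h : cycle_graph 4) :
  10 < k -> b_vertex c (inl (inr e)) -> u \in val e -> ~~ b_vertex c (inr (u, h)).
Proof.
move=> k10 be ue; apply/negP=> bh.
have dk : #|neighbours (inl (inr e) : G)| < k by rewrite degree_edge card_ord.
have Ne l : inr (u, l) \in neighbours (inl (inr e) : G) by rewrite inE.
have [/eqP] := b_vertex_inj be dk (Ne _) (Ne _) (color_antipode bh).
by rewrite (negPf (antipode_neq h)).
Qed.

Local Open Scope ring_scope.

Definition color_delta (x : 'I_k) : 'rV[rat]_k := delta_mx ord0 x.

Definition copy_vector (u : complete_graph n) : 'rV[rat]_k :=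
  if [pick h | b_vertex c (inr (u, h))] is Some h then color_delta (c (inr (u, h)))
  else color_delta (c (inl (inl u))) + \sum_h color_delta (c (inr (u, h))).

(** The degree 10 is below k, so each color but that of [e] occurs exactly once around [e]. The
    copies at its ends contain no b-vertex, so their [copy_vector] is the full sum. *)
Lemma color_delta_edge (e : edge (complete_graph n)) :
  (10 < k)%N -> b_vertex c (inl (inr e)) ->
  color_delta (c (inl (inr e))) = const_mx 1 - \sum_(u in val e) copy_vector u.
Proof.
move=> k10 be; apply/eqP; rewrite eq_sym subr_eq; apply/eqP.
have dk : (#|neighbours (inl (inr e) : G)| < k)%N by rewrite degree_edge card_ord.
have -> : \sum_(u in val e) copy_vector u =
    \sum_(w in neighbours (inl (inr e) : G)) color_delta (c w).
  rewrite big_neighbours_edge; apply: eq_bigr => u ue; rewrite /copy_vector.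
  by case: pickP => // h; rewrite (negPf (b_vertex_edge_copy h k10 be ue)).
rewrite -(big_imset color_delta (b_vertex_inj be dk)) b_vertex_imset //=.
rewrite (_ : const_mx 1 = \sum_x color_delta x).
  by rewrite (bigD1 (c (inl (inr e)))) //=; congr (_ + _);
    apply: eq_bigl => x; rewrite !inE.
apply/rowP=> x; rewrite summxE mxE (bigD1 x) //= big1 ?mxE ?eqxx ?addr0 // => y yx.
by rewrite mxE eqxx eq_sym (negPf yx).
Qed.
End C4.

Lemma not_b_colorable_complete_C4 (n : nat) : n = 2 \/ 9 <= n ->
  ~~ b_colorable (svn_corona (complete_graph n) (cycle_graph 4)) n.+2.
Proof.
move=> n29; apply/negP=> /existsP[c /andP[cP /forallP bP]].
pose M : 'M[rat]_(n, n.+2) := (\matrix_(u < n) copy_vector c u)%R.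
have Mu u : (copy_vector c u <= M)%MS.
  by rewrite -[copy_vector c u](rowK (copy_vector c)) row_sub.
have n0 : 0 < n by lia.
(* Copy b-vertices have their color vector in [M], and original vertices have too small a degree;
   only the edge b-vertices need the extra row [w]. *)
suff [w wP] : exists w : 'rV_n.+2, forall e, b_vertex c (inl (inr e)) ->
    (color_delta (c (inl (inr e))) <= w + M)%MS.
  suff : n.+2 <= n.+1 by lia.
  apply: (@leq_of_span _ _ _ w M) => x.
  have /existsP[v /andP[/eqP <-]] := bP x; case: v => [[u|e]|[u h]] bv.
  - exfalso; have := leq_trans (b_vertex_degree bv) (degree_vertex _ u); lia.
  - exact: wP.
  - apply: submx_trans (addsmxSr _ _); apply: submx_trans (Mu u).
    rewrite /copy_vector; case: pickP => [h' bh'|/(_ h)]; last by rewrite bv.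
    by rewrite (b_vertex_copy_color _ n0 _ bh' bv) ?submx_refl.
case: n29 => [n2|n9].
  have e1 : #|edge (complete_graph n)| <= 1.
    by apply: leq_trans (card_complete_edge n) _; rewrite n2.
  have [e _|e0] := pickP (mem (edge (complete_graph n))).
    exists (color_delta (c (inl (inr e)))) => e' _.
    by rewrite (fintype_le1P e1 e' e) addsmxSl.
  by exists 0%R => e; have := e0 e.
exists (const_mx 1%R) => e be; have n8 : 10 < n.+2 by lia.
rewrite (color_delta_edge cP n8 be).
rewrite addmx_sub ?addsmxSl // eqmx_opp summx_sub // => u _.
by apply: submx_trans (addsmxSr _ _); exact: Mu.
Qed.

Theorem theorem21 (n t : nat) (hn : 1 < n) (ht : 2 < t) :
  ((n = 2 /\ t = 4) \/ (9 <= n /\ t = 4) ->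
     b_chromatic_number (svn_corona (complete_graph n) (cycle_graph t)) = n + 1)
  /\
  ((n = 2 /\ t <> 4) \/ (n = 3 \/ n = 4) \/ (2 * t + 1 <= n /\ t <> 4) ->
     b_chromatic_number (svn_corona (complete_graph n) (cycle_graph t)) = n + 2).
Proof.
rewrite addn1 addn2; split=> H; apply/eqP; rewrite eqn_leq; apply/andP; split.
- have t4 : t = 4 by lia.
  have n29 : n = 2 \/ 9 <= n by lia.
  subst t; apply/bigmax_leqP=> k bk; rewrite -ltnS ltn_neqAle.
  have nt : n <= 4 \/ 2 * 4 < n by lia.
  rewrite (b_colorable_complete_cycle_leq hn nt bk) andbT.
  by apply: contraTneq bk => ->; exact: not_b_colorable_complete_C4.
- have -> : t = 4 by lia.
  exact: b_chromatic_number_max (b_colorable_complete_C4 hn).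
- apply/bigmax_leqP=> k bk; apply: b_colorable_complete_cycle_leq hn _ bk; lia.
- apply: b_chromatic_number_max; have [t4|/eqP t4] := eqVneq t 4; last first.
    exact: b_colorable_complete_cycle.
  have [->|->] : n = 3 \/ n = 4 by lia.
    rewrite t4; exact: b_colorable_K3_C4.
  rewrite t4; exact: b_colorable_K4_C4.
Qed.
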